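(* Let $\Delta$ be a positive integer and let $G$ be a connected weighted triangle-free graph with weights $w:E(G)\to\mathbb{R}_+$ and maximum degree $\Delta(G)\le\Delta$. Then $\mathrm{mac}(G)\ge s_\Delta\, w(G)$, where $s_\Delta=\frac12+\frac{1}{4\sqrt{2\Delta}}$.
   Context: $\mathbb{R}_+$ denotes the non-negative reals; $w(G)$ is the sum of all edge weights. $\mathrm{mac}(G)$ is the maximum total weight of the edges between $A$ and $B$ over all partitions $(A,B)$ of $V(G)$. Triangle-free means containing no $K_3$ subgraph. *)

(* Defs.v *)
From HB Require Import structures.
From mathcomp Require Import all_boot all_order all_algebra.
From mathcomp Require Import reals.

Set Implicit Arguments.
Unset Strict Implicit.
Unset Printing Implicit Defensive.

Import Order.TTheory GRing.Theory Num.Theory.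

Local Open Scope ring_scope.

Record sgraph := SGraph {
  vertex :> finType;
  adj : rel vertex;
  adj_sym : symmetric adj;
  adj_irrefl : irreflexive adj
}.

(* An edge is the two-element set of its endpoints, so each edge is counted
   once in sums over [edges G]. *)
Definition edges (G : sgraph) : {set {set G}} :=
  [set [set p.1; p.2] | p : G * G & adj p.1 p.2].

Definition connected_graph (G : sgraph) : Prop :=
  (0 < #|G|)%N /\ forall x y : G, connect (@adj G) x y.

Definition triangle_free (G : sgraph) : Prop :=
  forall x y z : G, ~ [/\ adj x y, adj y z & adj x z].

Definition degree (G : sgraph) (x : G) : nat := #|[set y : G | adj x y]|.

Definition max_degree (G : sgraph) : nat := (\max_(x : G) degree x)%N.

(* Weights are total functions on vertex sets; only their values on edges are
   ever used. *)
Definition nonneg_weight (R : realType) (G : sgraph) (w : {set G} -> R) : Prop :=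
  forall f, f \in edges G -> 0 <= w f.

Definition total_weight (R : realType) (G : sgraph) (w : {set G} -> R) : R :=
  \sum_(f in edges G) w f.

Definition weight_between (R : realType) (G : sgraph) (w : {set G} -> R)
    (A B : {set G}) : R :=
  \sum_(f in edges G | [exists a in A, exists b in B, f == [set a; b]]) w f.

(* Partitions (A, B) range over all (A, ~: A), with empty parts allowed; the
   initial value of the maximum is the one attained at A = set0. *)
Definition mac (R : realType) (G : sgraph) (w : {set G} -> R) : R :=
  \big[Num.max/weight_between w set0 (~: set0)]_(A : {set G})
     weight_between w A (~: A).

(* Main.v *)
(** Shearer's argument.  Give the vertices independent uniform signs [x_v] and let
    [M_v] be the sign (in {-1, 0, 1}) of the sum of the [x_u] over the neighbours
    [u] of [v].  The fractional assignment [y_v = (x_v - M_v) / 2] lies in [-1, 1],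
    hence can be rounded at random to a cut without changing the expectation of
    any product [y_u y_v].  For an edge [uv] the neighbourhoods of [u] and [v] are
    disjoint, so in [4 E(y_u y_v)] only [- E(x_u M_v) - E(x_v M_u)] survives.
    Each of these two correlations is the influence of one voter on the majority
    vote of [d] voters, a normalised central binomial coefficient, which is at
    least [1 / sqrt (2 d)]. *)
Require Import Defs.
From HB Require Import structures.
From mathcomp Require Import all_boot all_order all_algebra.
From mathcomp Require Import reals.
From mathcomp Require Import ring lra zify.

Set Implicit Arguments.
Unset Strict Implicit.
Unset Printing Implicit Defensive.

Import Order.TTheory GRing.Theory Num.Theory.

Local Open Scope ring_scope.

(** * Central binomial coefficients *)

Lemma bin_middle n k : n = k.*2.+1 -> 'C(n, k.+1) = 'C(n, k).
Proof.
move=> en; rewrite -(@bin_sub n k); last by lia.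
by congr 'C(_, _); lia.
Qed.

(** Induction on the ratio of consecutive central coefficients. The index is shifted because with
    [k] in place of [k.+1] the bound would fail at [k = 0]; here the base case is an equality. *)
Lemma central_bin_lower_bound (k : nat) :
  (16 ^ k.+1 <= 4 * k.+1 * 'C(k.+1.*2, k.+1) ^ 2)%N.
Proof.
elim: k => [|k IHk]; first by [].
have e : (k.+2 * 'C(k.+2.*2, k.+2) = 2 * k.+1.*2.+1 * 'C(k.+1.*2, k.+1))%N.
  rewrite [in LHS]doubleS -mul_bin_diag [_.-1]/= -(bin_middle (erefl k.+1.*2.+1)).
  have -> : (k.+1.*2.+2 = 2 * k.+2)%N by lia.
  by rewrite -mulnA -mul_bin_diag mulnA.
rewrite -(@leq_pmul2r k.+2) // expnS.
have -> : (4 * k.+2 * 'C(k.+2.*2, k.+2) ^ 2 * k.+2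
           = 4 * (k.+2 * 'C(k.+2.*2, k.+2)) ^ 2)%N by ring.
rewrite e; move: ('C(_, _)) IHk => c IHk.
apply: (@leq_trans (16 * (4 * k.+1 * c ^ 2) * k.+2)).
  by rewrite !leq_pmul2r ?leq_pmul2l.
have -> : (16 * (4 * k.+1 * c ^ 2) * k.+2 = (4 * k.+1 * k.+2) * (16 * c ^ 2))%N by ring.
have -> : (4 * (2 * k.+1.*2.+1 * c) ^ 2 = k.+1.*2.+1 ^ 2 * (16 * c ^ 2))%N by ring.
(* What remains is [4 (k+1) (k+2) <= (2k+3)^2], whose sides differ by 1. *)
by apply: leq_mul => //; nia.
Qed.

(** * Uniform signs on the cube and the influence of one voter *)

Section Cube.

Variables (R : realType) (T : finType).

Implicit Types (x : {ffun T -> bool}) (A B : {set T}) (u v : T).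

Definition sign x u : R := (-1) ^+ x u.

Definition sign_sum A x : R := \sum_(z in A) sign x z.

Definition flip A x : {ffun T -> bool} := [ffun z => x z (+) (z \in A)].

Local Notation N := (#|{ffun T -> bool}|%:R : R).

Lemma flipK A : involutive (flip A).
Proof. by move=> x; apply/ffunP=> z; rewrite !ffunE addbK. Qed.

Lemma sign_flip A x u : sign (flip A x) u = (-1) ^+ (u \in A) * sign x u.
Proof. by rewrite /sign ffunE signr_addb mulrC. Qed.

Lemma sign_sum_flip A x : sign_sum A (flip A x) = - sign_sum A x.
Proof.
rewrite /sign_sum -sumrN; apply: eq_bigr => z zA.
by rewrite sign_flip zA mulN1r.
Qed.

Lemma sign_sum_flip_disjoint A B x :
  [disjoint A & B] -> sign_sum A (flip B x) = sign_sum A x.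
Proof.
move=> dAB; apply: eq_bigr => z zA.
by rewrite sign_flip (disjointFr dAB zA) mul1r.
Qed.

Lemma sum_flip A (F : {ffun T -> bool} -> R) :
  \sum_x F x = \sum_x F (flip A x).
Proof. by rewrite (reindex_inj (inv_inj (flipK A))). Qed.

Lemma sum_flip_odd A (F : {ffun T -> bool} -> R) :
  (forall x, F (flip A x) = - F x) -> \sum_x F x = 0.
Proof.
move=> oddF; have := sum_flip A F.
by rewrite (eq_bigr _ (fun x _ => oddF x)) sumrN; lra.
Qed.

Lemma sum_flip_half A (F : {ffun T -> bool} -> R) :
  \sum_x F x = \sum_x (F x + F (flip A x)) / 2.
Proof. by rewrite -mulr_suml big_split /= -sum_flip; lra. Qed.

(** Conditioning on the sign of [u]: each [x] is averaged with its flip at [u], which leaves the sum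
    over [A :\ u] unchanged. *)
Lemma sum_condition u A (h : R -> R -> R) : u \in A ->
  \sum_x h (sign x u) (sign_sum A x) =
  \sum_x (h 1 (sign_sum (A :\ u) x + 1) + h (-1) (sign_sum (A :\ u) x - 1)) / 2.
Proof.
move=> uA; rewrite (sum_flip_half [set u]); apply: eq_bigr => x _.
have split_u y : sign_sum A y = sign y u + sign_sum (A :\ u) y.
  by rewrite /sign_sum (big_setD1 u uA).
rewrite !split_u sign_sum_flip_disjoint; last by rewrite disjoint_sym disjoints1 !inE eqxx.
rewrite sign_flip set11 expr1 mulN1r /sign !(addrC (sign_sum _ _)).
by case: (x u); rewrite ?expr1 ?expr0 ?opprK //; congr (_ / _); exact: addrC.
Qed.

(** A sum of [n] independent signs is a centred binomial variable: conditioning on one element of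
    [A] at a time reproduces Pascal's rule. *)
Lemma sum_sign_sum n A (h : R -> R) : #|A| = n ->
  \sum_x h (sign_sum A x) =
  N * (\sum_(i < n.+1) 'C(n, i)%:R * h (2 * i%:R - n%:R)) / 2 ^+ n.
Proof.
elim: n A h => [|n IHn] A h cA.
  rewrite big_ord_recl big_ord0 bin0 expr0 divr1 mul1r addr0 mulr0 subr0.
  rewrite (eq_bigr (fun=> h 0)) ?sumr_const ?mulr_natl // => x _.
  by move/eqP: cA; rewrite cards_eq0 => /eqP ->; rewrite /sign_sum big_set0.
have /card_gt0P[u uA] : (0 < #|A|)%N by rewrite cA.
have cAu : #|A :\ u| = n by move: (cardsD1 u A); rewrite uA cA => -[].
rewrite (sum_condition (fun=> h) uA).
rewrite (IHn _ (fun t => (h (t + 1) + h (t - 1)) / 2) cAu).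
rewrite exprS invfM mulrA; congr (_ / _); rewrite -mulrA; congr (_ * _).
rewrite [in RHS]big_ord_recl bin0 mul1r mulr0 sub0r.
under [in RHS]eq_bigr => i _ do
  rewrite lift0 binS natrD mulrDl.
rewrite [in RHS]big_split [in RHS]big_ord_recr /= bin_small // mul0r addr0 addrA.
have -> : h (- n.+1%:R) + \sum_(i < n) 'C(n, i.+1)%:R * h (2 * i.+1%:R - n.+1%:R)
   = \sum_(i < n.+1) 'C(n, i)%:R * h (2 * i%:R - n.+1%:R).
  rewrite [RHS]big_ord_recl bin0 mul1r mulr0 sub0r.
  by congr (_ + _); apply: eq_bigr.
rewrite -big_split mulr_suml; apply: eq_bigr => i _ /=.
have -> : 2 * i%:R - n%:R + 1 = 2 * i.+1%:R - n.+1%:R :> R by rewrite -!natr1; ring.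
have -> : 2 * i%:R - n%:R - 1 = 2 * i%:R - n.+1%:R :> R by rewrite -!natr1; ring.
by ring.
Qed.

(** The influence of one voter when the others sum to [t]: 1 at a tie, 1/2 at [t = 1] and [t = -1],
    and 0 at all other integers. *)
Definition pivot (t : R) : R := (Num.sg (t + 1) - Num.sg (t - 1)) / 2.

Lemma pivot_ge0 t : 0 <= pivot t.
Proof.
rewrite /pivot divr_ge0 // subr_ge0.
case: (ltrP 0 (t - 1)) => [h|h].
  by rewrite !gtr0_sg //; lra.
case: (ltrP (t - 1) 0) => [h'|h'].
  rewrite (ltr0_sg h').
  by case: sgrP => _; lra.
have -> : t = 1 by lra.
by rewrite subrr sgr0 sgr_ge0; lra.
Qed.

Lemma pivot0 : pivot 0 = 1.
Proof. rewrite /pivot add0r sub0r sgrN sgr1; lra. Qed.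

Lemma pivot1 : pivot 1 = 1 / 2.
Proof. rewrite /pivot subrr sgr0 gtr0_sg; lra. Qed.

Lemma pivotN1 : pivot (-1) = 1 / 2.
Proof. rewrite /pivot addNr sgr0 ltr0_sg; lra. Qed.

(** Only the middle of the row is pivotal, so the sum is at least the coefficient ['C(n, n./2)],
    which the central binomial bound controls. *)
Lemma binomial_pivot_lower_bound n :
  1 / Num.sqrt (2 * n.+1%:R) <=
  (\sum_(i < n.+1) 'C(n, i)%:R * pivot (2 * i%:R - n%:R)) / 2 ^+ n.
Proof.
set S := \sum_(i < _) _.
have S0 : 0 <= S by apply: sumr_ge0 => i _; rewrite mulr_ge0 ?pivot_ge0.
suff sq : 4 ^+ n <= S ^+ 2 * (2 * n.+1%:R).
  have pos : 0 < Num.sqrt (2 * n.+1%:R : R) by rewrite sqrtr_gt0 mulr_gt0 ?ltr0n.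
  rewrite ler_pdivlMr ?exprn_gt0 // mulrC mulrA mulr1 ler_pdivrMr //.
  rewrite -(@ler_pXn2r _ 2) ?nnegrE ?exprn_ge0 ?mulr_ge0 //; last exact: ltW.
  rewrite exprMn sqr_sqrtr ?mulr_ge0 // -exprM mulnC exprM.
  by have -> : 2 ^+ 2 = 4 :> R by ring.
have nonneg (i : 'I_n.+1) : 0 <= 'C(n, i)%:R * pivot (2 * i%:R - n%:R).
  by rewrite mulr_ge0 ?pivot_ge0.
case: (boolP (odd n)) => par.
(* For odd [n] the two middle terms, at [-1] and [1], have equal coefficients and count half
   each. *)
- pose k := n./2; have en : n = k.*2.+1 by rewrite -[LHS]odd_double_half par.
  have lk : (k < n.+1)%N by lia.
  have lk1 : (k.+1 < n.+1)%N by lia.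
  have SC : 'C(n, k)%:R <= S.
    rewrite /S (bigD1 (Ordinal lk)) // (bigD1 (Ordinal lk1)) /=; last first.
      by rewrite -val_eqE /=; lia.
    rewrite (bin_middle en).
    have -> : 2 * k%:R - n%:R = -1 :> R.
      by rewrite en -(natr1 k.*2) -muln2 natrM; ring.
    have -> : 2 * k.+1%:R - n%:R = 1 :> R.
      by rewrite en -(natr1 k.*2) -(natr1 k) -muln2 natrM; ring.
    rewrite pivot1 pivotN1.
    set rest := \sum_(i < _ | _) _; have : 0 <= rest by apply: sumr_ge0.
    by lra.
  apply: (@le_trans _ _ ('C(n, k)%:R ^+ 2 * (2 * n.+1%:R))); last first.
    by rewrite ler_wpM2r ?ler_pXn2r ?nnegrE ?mulr_ge0 ?ler0n.
  have e : ('C(k.+1.*2, k.+1) = 2 * 'C(n, k))%N.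
    by rewrite doubleS binS -en (bin_middle en) addnn mul2n.
  have := central_bin_lower_bound k; rewrite e.
  have -> : (16 ^ k.+1 = 4 * 4 ^ n)%N.
    by rewrite -expnS en -doubleS -mul2n expnM.
  rewrite -!natrX -!natrM ler_nat (_ : n.+1 = 2 * k.+1)%N; last by lia.
  by nia.
- pose k := n./2; have en : n = k.*2.
    by rewrite -[LHS]odd_double_half (negbTE par).
  have lk : (k < n.+1)%N by lia.
  have SC : 'C(n, k)%:R <= S.
    rewrite /S (bigD1 (Ordinal lk)) //=.
    have -> : 2 * k%:R - n%:R = 0 :> R by rewrite en -muln2 natrM; ring.
    by rewrite pivot0 mulr1 lerDl sumr_ge0.
  apply: (@le_trans _ _ ('C(n, k)%:R ^+ 2 * (2 * n.+1%:R))); last first.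
    by rewrite ler_wpM2r ?ler_pXn2r ?nnegrE ?mulr_ge0 ?ler0n.
  rewrite -!natrX -!natrM ler_nat.
  (* The central binomial bound starts at row 2, so [n = 0] is checked directly. *)
  case: k en {lk SC} => [|k] en; first by rewrite en.
  have := central_bin_lower_bound k; rewrite -en.
  have -> : (16 ^ k.+1 = 4 ^ n)%N by rewrite en -mul2n expnM.
  move/leq_trans; apply; rewrite mulnC leq_mul // en; lia.
Qed.

(** Conditioning on the sign of [u] turns the correlation into the mean of [pivot] over the other
    [#|A| - 1] voters. *)
Lemma majority_correlation u A : u \in A ->
  N / Num.sqrt (2 * #|A|%:R) <= \sum_x sign x u * Num.sg (sign_sum A x).
Proof.
move=> uA; rewrite (sum_condition (fun a b => a * Num.sg b) uA).
rewrite (eq_bigr (fun x => pivot (sign_sum (A :\ u) x))); last first.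
  by move=> x _; rewrite mul1r mulN1r.
rewrite (sum_sign_sum pivot (erefl #|A :\ u|)).
have -> : #|A| = #|A :\ u|.+1 by rewrite (cardsD1 u A) uA.
rewrite -mulrA ler_wpM2l // -[X in X <= _]mul1r.
exact: binomial_pivot_lower_bound.
Qed.

(** * The fractional assignment and its rounding *)

Definition majority_step (Nb : T -> {set T}) x u : R :=
  (sign x u - Num.sg (sign_sum (Nb u) x)) / 2.

Lemma majority_step_bound Nb x u : `|majority_step Nb x u| <= 1.
Proof.
rewrite ler_norml /majority_step /sign.
by case: (x u); case: sgrP => _; rewrite ?expr1 ?expr0; apply/andP; split; lra.
Qed.

Lemma majority_step_correlation (Nb : T -> {set T}) D u v :
  u != v -> u \in Nb v -> v \in Nb u -> [disjoint Nb u & Nb v] ->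
  (#|Nb u| <= D)%N -> (#|Nb v| <= D)%N ->
  \sum_x majority_step Nb x u * majority_step Nb x v
    <= - (N / (2 * Num.sqrt (2 * D%:R))).
Proof.
move=> uv uNv vNu dis uD vD.
(* The bound decreases with the degree; [a] witnesses that the degree of [b] is positive, so the
   inverses can be compared. *)
have corr a b : a \in Nb b -> (#|Nb b| <= D)%N ->
    N / Num.sqrt (2 * D%:R) <= \sum_x sign x a * Num.sg (sign_sum (Nb b) x).
  move=> ab bD; apply: le_trans (majority_correlation ab).
  have b0 : (0 < #|Nb b|)%N by apply/card_gt0P; exists a.
  rewrite ler_wpM2l // lef_pV2 ?posrE ?sqrtr_gt0 ?mulr_gt0 ?ltr0n //.
    by rewrite ler_wsqrtr // ler_wpM2l // ler_nat.
  exact: leq_trans bD.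
(* Flipping [u] alone negates the product. *)
have ss : \sum_x sign x u * sign x v = 0.
  apply: (sum_flip_odd (A := [set u])) => x.
  by rewrite !sign_flip !inE eqxx eq_sym (negbTE uv) expr1 mulN1r mul1r mulNr.
(* Flipping all of [Nb u] negates the majority at [u] and, by disjointness, fixes the one at [v]. *)
have mm : \sum_x Num.sg (sign_sum (Nb u) x) * Num.sg (sign_sum (Nb v) x) = 0.
  apply: (sum_flip_odd (A := Nb u)) => x.
  by rewrite sign_sum_flip sign_sum_flip_disjoint 1?disjoint_sym // sgrN mulNr.
rewrite (eq_bigr (fun x => (sign x u * sign x v
   + Num.sg (sign_sum (Nb u) x) * Num.sg (sign_sum (Nb v) x)) / 4
   - (sign x v * Num.sg (sign_sum (Nb u) x)
      + sign x u * Num.sg (sign_sum (Nb v) x)) / 4)); last first.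
  by move=> x _; rewrite /majority_step /=; field.
rewrite big_split /= sumrN -!mulr_suml !big_split /= ss mm invfM.
have := corr _ _ uNv vD; have := corr _ _ vNu uD.
by set a := \sum_x _; set b := \sum_x _; rewrite mulrCA; set c := N / _; lra.
Qed.

(* The coordinates of [x] are rounded independently, [sign x z] having mean [y z]. *)
Lemma product_rounding (I : finType) (P : pred I) (e : I -> {set T})
    (w : I -> R) (y : T -> R) (m : R) :
  (forall z, `|y z| <= 1) ->
  (forall x, \sum_(i | P i) w i * ((1 - \prod_(z in e i) sign x z) / 2) <= m) ->
  \sum_(i | P i) w i * ((1 - \prod_(z in e i) y z) / 2) <= m.
Proof.
move=> y1 cut.
(* [p z] is the law of a sign with mean [y z], nonnegative since [y z] lies in [-1, 1]; [W] is the
   product law. *)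
pose p z (b : bool) : R := (1 + (-1) ^+ b * y z) / 2.
pose W x := \prod_z p z (x z).
have W0 x : 0 <= W x.
  apply: prodr_ge0 => z _; have := y1 z; rewrite ler_norml /p.
  by case: (x z); rewrite ?expr1 ?expr0; lra.
(* By independence the mean factorises: a coordinate in [f] contributes [y z], any other contributes
   1. The case [f = set0] gives total mass 1. *)
have WE (f : {set T}) : \sum_x W x * \prod_(z in f) sign x z = \prod_(z in f) y z.
  pose q z (b : bool) := p z b * (if z \in f then (-1) ^+ b else 1).
  rewrite (eq_bigr (fun x : {ffun T -> bool} => \prod_z q z (x z))); last first.
    by move=> x _; rewrite [X in _ * X]big_mkcond -big_split.
  rewrite -bigA_distr_bigA [RHS]big_mkcond; apply: eq_bigr => z _.
  by rewrite big_bool /q /p; case: ifP => _; rewrite expr1 expr0 /=; field.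
have W1 : \sum_x W x = 1.
  have := WE set0; rewrite big_set0 => <-.
  by apply: eq_bigr => x _; rewrite big_set0 mulr1.
have : \sum_x W x * (\sum_(i | P i) w i * ((1 - \prod_(z in e i) sign x z) / 2))
        <= \sum_x W x * m.
  by apply: ler_sum => x _; apply: ler_wpM2l.
rewrite -mulr_suml W1 mul1r; apply: le_trans.
under [X in _ <= X]eq_bigr do rewrite mulr_sumr.
rewrite exchange_big /= le_eqVlt; apply/orP; left; apply/eqP.
apply: eq_bigr => i _; rewrite -WE -[X in X - _]W1 -sumrB mulr_suml mulr_sumr.
by apply: eq_bigr => x _; ring.
Qed.

End Cube.

(** * Cuts of a weighted graph *)

Section Cut.

Variables (R : realType) (G : sgraph) (w : {set G} -> R).

Lemma edgesP (f : {set G}) :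
  reflect (exists u v : G, adj u v /\ f = [set u; v]) (f \in edges G).
Proof.
apply: (iffP imsetP) => [[[u v] + ->]|[u [v [uv ->]]]]; first by rewrite inE; exists u, v.
by exists (u, v); rewrite ?inE.
Qed.

Lemma adj_neq (u v : G) : adj u v -> u != v.
Proof. by apply: contraTneq => ->; rewrite adj_irrefl. Qed.

Lemma prod_edge (y : G -> R) (u v : G) :
  adj u v -> \prod_(z in [set u; v]) y z = y u * y v.
Proof. by move=> /adj_neq uv; rewrite big_setU1 ?big_set1 ?inE. Qed.

(** On an edge [(1 - x_u x_v) / 2] is the indicator of being cut; this is the form that
    [product_rounding] accepts. *)
Lemma weight_between_sign (x : {ffun G -> bool}) :
  weight_between w [set z | x z] (~: [set z | x z]) =
  \sum_(f in edges G) w f * ((1 - \prod_(z in f) sign R x z) / 2).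
Proof.
rewrite /weight_between big_mkcondr; apply: eq_bigr => f /edgesP[u [v [uv ->]]].
rewrite prod_edge // /sign.
have -> : [exists a in [set z | x z], exists b in ~: [set z | x z],
             [set u; v] == [set a; b]] = (x u != x v).
  apply/existsP/idP => [[a /andP[]]|].
    rewrite inE => xa /existsP[b /andP[]]; rewrite !inE => xb /eqP e.
    have : a \in [set u; v] by rewrite e set21.
    have : b \in [set u; v] by rewrite e set22.
    rewrite !inE; move: xa xb => xa xb.
    by case/orP=> /eqP eb; case/orP=> /eqP ea; move: xa xb;
      rewrite ?ea ?eb; case: (x u); case: (x v).
  case xu: (x u); case xv: (x v) => // _.
    exists u; rewrite inE xu; apply/existsP; exists v.
    by rewrite !inE xv eqxx.
  exists v; rewrite inE xv; apply/existsP; exists u.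
  by rewrite !inE xu setUC eqxx.
by case: (x u); case: (x v); rewrite /= ?expr1 ?expr0; field.
Qed.

Lemma weight_between_le_mac (A : {set G}) : weight_between w A (~: A) <= mac w.
Proof. by rewrite /mac (bigD1 A) //= le_max lexx. Qed.

End Cut.

Theorem theorem5p10 (R : realType) (Delta : nat) (hDelta : (0 < Delta)%N)
    (G : sgraph) (w : {set G} -> R)
    (hconn : connected_graph G) (htri : triangle_free G)
    (hw : nonneg_weight w) (hdeg : (max_degree G <= Delta)%N) :
  (1 / 2 + 1 / (4 * Num.sqrt (2 * Delta%:R))) * total_weight w <= mac w.
Proof.
pose Nb (u : G) : {set G} := [set z : G | adj u z].
pose y x := majority_step R Nb x.
set N : R := #|{ffun G -> bool}|%:R.
have N0 : 0 < N by rewrite ltr0n; apply/card_gt0P; exists [ffun=> true].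
have round x :
    \sum_(f in edges G) w f * ((1 - \prod_(z in f) y x z) / 2) <= mac w.
  apply: (product_rounding (e := id)) => [z|x']; first exact: majority_step_bound.
  by rewrite -weight_between_sign weight_between_le_mac.
rewrite -(ler_pM2l N0).
have -> : N * mac w = \sum_(x : {ffun G -> bool}) mac w.
  by rewrite sumr_const -mulr_natl.
(* Averaging over all [x] leaves a comparison edge by edge, where nonnegativity of the weight is
   used. *)
apply: le_trans (ler_sum _ (fun x _ => round x)).
rewrite exchange_big mulrA /total_weight mulr_sumr /=.
apply: ler_sum => f fE; have wf := hw f fE.
rewrite -mulr_sumr mulrC ler_wpM2l // -mulr_suml sumrB sumr_const -/N.
have /edgesP[u [v [uv ->]]] := fE.
rewrite (eq_bigr (fun x => y x u * y x v)); last by move=> x _; rewrite prod_edge.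
have degD z : (#|Nb z| <= Delta)%N.
  by apply: leq_trans hdeg; apply: (leq_bigmax z).
(* A common neighbour of [u] and [v] would close a triangle. *)
have dis : [disjoint Nb u & Nb v].
  rewrite disjoint_subset; apply/subsetP => z; rewrite !inE => uz.
  apply/negP => vz; exact: (htri u v z).
(* The edge contributes [(N - E) / 2] with [E <= - N / (2 sqrt (2 Delta))], which gives the constant
   of the theorem. *)
have := majority_step_correlation R (adj_neq uv) _ _ dis (degD u) (degD v).
rewrite !inE uv adj_sym uv => /(_ isT isT).
rewrite -/N !invfM; set s := (Num.sqrt _)^-1; set E := \sum_x _.
by lra.
Qed.
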